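(* Let $\mathcal P=\{C_k\}_{k\in\mathbb N\cup\{0\}}$ be a packing, let $D_k$ be the bounded component of the complement of $C_k$, and suppose that there is a constant $\alpha\ge1$ such that for each $D_k$ there exist inscribed and circumscribed concentric circles of radii $r_k$ and $R_k$, respectively, with $R_k/r_k\le\alpha$. Then $$\limsup_{x\to\infty}\frac{\log N(x)}{\log x}=E,$$ where $N(x)=\#\{k : (\operatorname{diam} C_k)^{-1}\le x\}$, $x\in\mathbb R$, is the curvature distribution function of $\mathcal P$ and $E=\inf\{t\in\mathbb R : \sum_k(\operatorname{diam} C_k)^t<\infty\}$ is the exponent of $\mathcal P$.
   Context: Packing: a collection $\{C_k\}_{k\in\mathbb N\cup\{0\}}$ of simple closed curves in the plane, with $D_k$ denoting the bounded component of the complement of $C_k$, such that $C_k\subset\overline{D_0}$ for every $k\in\mathbb N$ and $D_j\cap D_k=\emptyset$ for all $j,k\in\mathbb N$ with $j\ne k$. Inscribed and circumscribed concentric circles of radii $r_k,R_k$ for $D_k$: there is a point $p_k$ such that $B(p_k,r_k)\subset D_k\subset\overline{B(p_k,R_k)}$, where $B(p,r)$ is the open disc of radius $r$ centered at $p$. $\operatorname{diam}$ is the Euclidean diameter. *)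

(* Defs.v *)
From mathcomp Require Export all_boot all_order all_algebra.
From mathcomp Require Export all_classical all_reals all_analysis.
Export Order.TTheory GRing.Theory Num.Theory.
Export numFieldNormedType.Exports.

Set Implicit Arguments.
Unset Strict Implicit.
Unset Printing Implicit Defensive.

Local Open Scope classical_set_scope.
Local Open Scope ring_scope.

(* The plane is R * R, whose library topology is the usual one. The library
   norm on R * R is the max norm, so the Euclidean metric is defined here. *)
Section Plane.
Variable R : realType.
Implicit Types (p q : R * R) (A C D : set (R * R)).

Definition edist p q : R :=
  Num.sqrt ((p.1 - q.1) ^+ 2 + (p.2 - q.2) ^+ 2).

Definition open_disc p (r : R) : set (R * R) := [set q | edist p q < r].

Definition diam A : R := sup [set edist pq.1 pq.2 | pq in A `*` A].

Definition unit_circle : set (R * R) := [set p | p.1 ^+ 2 + p.2 ^+ 2 = 1].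

Definition simple_closed_curve C : Prop :=
  exists f : R * R -> R * R,
    [/\ {within unit_circle, continuous f},
        {in unit_circle &, injective f} &
        C = f @` unit_circle].

(* By the Jordan curve theorem there is exactly one such D when C is a simple
   closed curve. [bounded_set] refers to the max norm, which is equivalent to
   the Euclidean one. *)
Definition bounded_component_compl C D : Prop :=
  bounded_set D /\ exists2 x, (~` C) x & D = connected_component (~` C) x.

Definition packing (C D : nat -> set (R * R)) : Prop :=
  [/\ forall k, simple_closed_curve (C k),
      forall k, bounded_component_compl (C k) (D k),
      forall k, (0 < k)%N -> C k `<=` closure (D 0%N) &
      forall j k, (0 < j)%N -> (0 < k)%N -> j <> k -> D j `&` D k = set0].

Definition concentric_circles D p (r s : R) : Prop :=
  [/\ 0 < r, open_disc p r `<=` D & D `<=` closure (open_disc p s)].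

(* Extended-real valued: +oo if infinitely many indices are counted. *)
Definition curvature_distribution (C : nat -> set (R * R)) (x : R) : \bar R :=
  counting [set k | (diam (C k))^-1 <= x].

Definition packing_exponent (C : nat -> set (R * R)) : \bar R :=
  ereal_inf [set t%:E | t in
    [set t : R | (\sum_(0 <= k <oo) (diam (C k) `^ t)%:E < +oo)%E]].

End Plane.

(* Main.v *)
(* Write d_k = diam C_k. The argument rests on 0 < d_k <= M, where M
   exists because C_0 is compact and C_k lies in the closure of the bounded
   set D_0 for k > 0.
   If sum_k d_k^t is finite then t > 0 (the d_k are bounded above), and
   Markov's inequality gives N(x) <= x^t sum_k d_k^t, so limsup <= t.
   Conversely, if N(x) <= x^s for all x >= x0 and t > s, group the d_k along
   the scales x0 2^n: each d_k is at least (x0 2^n)^-1 and at most a constant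
   multiple of it for some n, so sum_k d_k^t is dominated by
   sum_n N(x0 2^n) (x0 2^n)^-t, hence by a geometric series of ratio
   2^(s-t). *)
Require Import Defs.
From mathcomp Require Import ring lra.

Local Open Scope classical_set_scope.
Local Open Scope ring_scope.

(** * Counting functions and sums of powers of a bounded positive sequence *)

Section CountingAndSeries.
Set Implicit Arguments.
Unset Strict Implicit.
Unset Printing Implicit Defensive.
Variable R : realType.
Implicit Types (u d : nat -> R) (s t x M : R).

(** Markov's inequality for the counting measure: [counting] is a sum of Dirac masses, so the series
    compare term by term. *)
Lemma counting_markov u c : (forall k, 0 <= u k) -> 0 <= c ->
  (c%:E * counting [set k | (c <= u k)%R] <= \sum_(0 <= k <oo) (u k)%:E)%E.
Proof.
move=> u0 c0; rewrite counting_dirac -nneseriesZl//.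
apply: lee_nneseries => [k _ _|k _]; first exact: mule_ge0.
rewrite diracE; have [|_] := boolP (k \in _); last by rewrite mule0 lee_fin.
by rewrite inE /= mule1 lee_fin.
Qed.

Lemma le_counting (A B : set nat) :
  A `<=` B -> (counting A <= counting B :> \bar R)%E.
Proof.
move=> AB; rewrite !counting_dirac; apply: lee_nneseries => // k _.
rewrite !diracE lee_fin ler_nat.
have [kA|//] := boolP (k \in A).
by rewrite (_ : k \in B)// inE; apply: AB; rewrite inE in kA.
Qed.

Lemma geometric_nneseries_lty a z : 0 <= a -> 0 <= z < 1 ->
  (\sum_(0 <= n <oo) (a * z ^+ n)%:E < +oo :> \bar R)%E.
Proof.
move=> a0 /andP[z0 z1].
rewrite (_ : (fun n => _) = EFin \o series (geometric a z)).
  rewrite EFin_lim ?ltry//.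
  by apply: is_cvg_geometric_series; rewrite ger0_norm.
by apply/funext => n; rewrite /= /series/= sumEFin.
Qed.

Lemma summable_powR_gt0 d M t : (forall k, 0 < d k <= M) ->
  (\sum_(0 <= k <oo) (d k `^ t)%:E < +oo)%E -> 0 < t.
Proof.
move=> dM sumlty; rewrite ltNge; apply/negP => t0; move: sumlty.
apply/negP; rewrite -leNgt leye_eq; apply/eqP.
have M0 : 0 < M by have /andP[/lt_le_trans] := dM 0%N; exact.
have := counting_markov (fun k => powR_ge0 (d k) t) (powR_ge0 M t).
rewrite (_ : [set k | _] = setT).
  rewrite /counting asboolF; last exact: infinite_nat.
  by rewrite gt0_muley ?lte_fin ?powR_gt0// leye_eq => /eqP.
apply/seteqP; split => // k _ /=; have /andP[d0 dkM] := dM k.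
rewrite -lef_pV2 ?posrE ?powR_gt0// -!powRN.
by apply: ge0_ler_powR; rewrite ?nnegrE ?oppr_ge0// ltW.
Qed.

Lemma summable_powR_counting d M s t x0 : (forall k, 0 < d k <= M) ->
  0 <= t -> s < t -> 0 < x0 ->
  (forall x, x0 <= x ->
    (counting [set k | ((d k)^-1 <= x)%R] <= (x `^ s)%:E)%E) ->
  (\sum_(0 <= k <oo) (d k `^ t)%:E < +oo)%E.
Proof.
move=> dM t0 st x00 cnt.
pose x n := x0 * 2 ^+ n.
have xgt0 n : 0 < x n by rewrite mulr_gt0// exprn_gt0.
(* For the least [n] with [(d k)^-1 <= x n]: if [n = 0], then [d k * x 0 <= M * x0]; otherwise
   minimality gives [d k * x n.-1 <= 1], and doubling the scale gives [d k * x n <= 2]. *)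
pose K := Num.max 2 (M * x0).
have K0 : 0 < K by rewrite lt_max ltr0n.
pose c n := K `^ t * x n `^ (- t).
have c0 n : 0 <= c n by rewrite mulr_ge0 ?powR_ge0.
pose A n := [set k | (d k)^-1 <= x n].
have term_ge0 n k : (0 <= (c n)%:E * \d_k (A n))%E.
  by rewrite mule_ge0// lee_fin.
have scale k : exists2 n, A n k & d k <= K / x n.
  have /andP[d0 dkM] := dM k.
  have exn : exists n, (d k)^-1 <= x n.
    exists (Num.bound ((d k)^-1 / x0)).
    rewrite /x -ler_pdivrMl// mulrC.
    apply: (le_trans (ltW (archi_boundP _))).
      by rewrite divr_ge0// ltW// invr_gt0.
    by rewrite -natrX ler_nat ltnW// ltn_expl.
  case: (ex_minnP exn) => n An minn; exists n => //.
  rewrite ler_pdivlMr//; case: n An minn => [|n] An minn.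
    rewrite /x expr0 mulr1 le_max; apply/orP; right.
    by rewrite ler_pM2r.
  have : x n <= (d k)^-1.
    by apply/ltW; rewrite ltNge; apply/negP => /minn; rewrite ltnn.
  rewrite -(ler_pM2l d0) mulfV ?gt_eqF// => h.
  have -> : d k * x n.+1 = 2 * (d k * x n) by rewrite /x exprS; ring.
  by rewrite le_max ler_piMr.
have dsum k : ((d k `^ t)%:E <= \sum_(0 <= n <oo) (c n)%:E * \d_k (A n))%E.
  have [n An dle] := scale k.
  apply: (@le_trans _ _ ((c n)%:E * \d_k (A n))%E).
    rewrite diracE mem_set// mule1 lee_fin /c.
    have -> : K `^ t * x n `^ (- t) = (K / x n) `^ t.
      rewrite (@powRM _ K (x n)^-1) ?invr_ge0 ?ltW//.
      by rewrite -(powR_inv1 (ltW (xgt0 n))) -powRrM mulN1r.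
    have /andP[d0 _] := dM k.
    by apply: ge0_ler_powR; rewrite ?nnegrE// ?ltW// divr_gt0.
  by rewrite (nneseriesD1 (n := n))// leeDl// nneseries_ge0.
apply: (@le_lt_trans _ _
  (\sum_(0 <= k <oo) \sum_(0 <= n <oo) (c n)%:E * \d_k (A n))%E).
  by apply: lee_nneseries => [k _ _|k _]; rewrite ?lee_fin ?powR_ge0.
(* After the exchange, the inner sum over [k] is [c n] times the count at scale [x n], to which the
   hypothesis on the counting function applies. *)
rewrite nneseries_interchange//.
pose z := 2 `^ (s - t) : R.
apply: le_lt_trans (@geometric_nneseries_lty (K `^ t * x0 `^ (s - t)) z _ _).
- apply: lee_nneseries => [n _ _|n _].
    exact: nneseries_ge0.
  rewrite nneseriesZl// -counting_dirac.
  apply: (@le_trans _ _ ((c n)%:E * (x n `^ s)%:E)%E).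
    apply: lee_wpmul2l; first by rewrite lee_fin.
    by apply: cnt; rewrite /x ler_peMr ?(ltW x00)// exprn_ege1// ler1n.
  rewrite -EFinM lee_fin /c -!mulrA -powRD; last first.
    by rewrite (gt_eqF (xgt0 n)) implybT.
  rewrite [- t + s]addrC /x powRM ?exprn_ge0 ?(ltW x00)//.
  by rewrite -powR_mulrn// -powR_mulrn ?powR_ge0// -!powRrM [n%:R * _]mulrC.
- by rewrite mulr_ge0 ?powR_ge0.
- rewrite powR_ge0 /=.
  rewrite /z /powR ?pnatr_eq0 /= -[ltRHS]expR0 ltr_expR pmulr_llt0 ?subr_lt0//.
  by rewrite ln_gt0 ?ltr1n.
Qed.

Definition growth d x : \bar R :=
  (lne (counting [set k | ((d k)^-1 <= x)%R]) / (ln x)%:E)%E.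

(** Since [ln x > 0], the division can be cleared; monotonicity of [lne] on [[0, +oo]] then also
    covers a count equal to 0 or [+oo]. *)
Lemma growth_leP d x (a : R) : 1 < x ->
  (growth d x <= a%:E)%E =
  (counting [set k | ((d k)^-1 <= x)%R] <= (x `^ a)%:E)%E.
Proof.
move=> x1; have lnx := ln_gt0 x1; have x0 : 0 < x by exact: lt_trans x1.
rewrite /growth inver gt_eqF// lee_pdivrMr// -EFinM -ln_powR.
rewrite -lne_EFin ?powR_gt0// lee_lne// in_itv/= leey andbT//.
by rewrite lee_fin powR_ge0.
Qed.

Lemma limf_esup_growth d M : (forall k, 0 < d k <= M) ->
  limf_esup (growth d) +oo =
  ereal_inf [set t%:E | t in
    [set t | (\sum_(0 <= k <oo) (d k `^ t)%:E < +oo)%E]].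
Proof.
move=> dM; apply/eqP; rewrite eq_le; apply/andP; split.
  apply/ereal_infP => _ [t /= sumt <-].
  have t0 := summable_powR_gt0 dM sumt.
  apply/lee_addgt0Pr => e e0.
  set S := (\sum_(0 <= k <oo) _)%E in sumt.
  have S0 : (0 <= S)%E by apply: nneseries_ge0 => *; rewrite lee_fin powR_ge0.
  have Sfin : S \is a fin_num by rewrite ge0_fin_numE.
  pose x1 := Num.max 1 ((fine S + 1) `^ e^-1).
  pose V : set R := [set x | x1 < x].
  apply: (@le_trans _ _ (ereal_sup (growth d @` V))).
    apply: ereal_inf_lbound; exists V => //.
    exact: nbhs_pinfty_gt (num_real x1).
  apply/ereal_supP => _ [x Vx <-].
  move: Vx; rewrite /V /= gt_max => /andP[xgt1 xS].
  have x0 : 0 < x by exact: lt_trans xgt1.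
  rewrite -EFinD growth_leP//.
  have mk := counting_markov (fun k => powR_ge0 (d k) t) (powR_ge0 x (- t)).
  (* As [t > 0], raising [x^-1 <= d k] to the power [t] puts the condition in the form used by
     Markov's inequality. *)
  apply: (@le_trans _ _ (counting [set k | (x `^ (- t) <= d k `^ t)%R])).
    apply: le_counting => k /= dkx; have /andP[d0 _] := dM k.
    rewrite powRN -powR_inv1 ?powR_ge0// powRAC.
    apply: ge0_ler_powR; rewrite ?nnegrE ?powR_ge0 ?(ltW t0) ?(ltW d0)//.
    by rewrite powR_inv1 ?(ltW x0)// -[leRHS]invrK lef_pV2 ?posrE ?invr_gt0.
  move: mk; rewrite powRN lee_pdivrMl ?powR_gt0// => /le_trans; apply.
  rewrite -/S -(fineK Sfin) -EFinM lee_fin powRD ?(gt_eqF x0) ?implybT//.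
  rewrite ler_pM2l ?powR_gt0//.
  apply: (@le_trans _ _ (fine S + 1)); first by rewrite lerDl.
  have fS : 0 <= fine S + 1 by rewrite addr_ge0 ?fine_ge0.
  have -> : fine S + 1 = ((fine S + 1) `^ e^-1) `^ e.
    by rewrite -powRrM mulVf ?lt0r_neq0// powRr1.
  apply: ge0_ler_powR; rewrite ?nnegrE ?powR_ge0 ?(ltW e0) ?(ltW x0)//.
  exact: ltW.
(* Conversely, a neighbourhood [V] of [+oo] contains a ray beyond [m], on which the supremum over
   [V] bounds the growth. *)
apply/ereal_infP => _ [V [m [_ Vm]] <-].
set sg := ereal_sup _.
have growthV x : m < x -> (growth d x <= sg)%E.
  by move=> mx; apply: ereal_sup_ubound; exists x => //; exact: Vm.
(* [m + 1] enters the ray, 2 makes the logarithm positive, and [(d 0%N)^-1] makes the index 0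
   counted, so that the growth at [x0] is nonnegative. *)
pose x0 := Num.max (m + 1) (Num.max 2 (d 0%N)^-1).
have mx0 : m < x0 by rewrite lt_max ltrDl ltr01.
have x01 : 1 < x0 by rewrite !lt_max ltr1n orbT.
have growth0 : (0 <= growth d x0)%E.
  rewrite /growth mule_ge0//; last first.
    by rewrite inve_ge0 lee_fin ln_ge0// ltW.
  rewrite lne_ge0.
  apply: le_trans (le_counting (_ : [set 0%N] `<=` _)).
    by rewrite /counting asboolT// fset_set1 finmap.cardfs1.
  by move=> _ -> /=; rewrite !le_max lexx !orbT.
(* This excludes [sg = -oo] and makes the exponent [s + e] below nonnegative. *)
have : (0 <= sg)%E by apply: le_trans growth0 (growthV _ mx0).
case: {+}sg growthV => [s|_ _|_]; [move=> growthV|exact: leey|by []].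
rewrite lee_fin => s0; apply/lee_addgt0Pr => e e0.
apply: ereal_inf_lbound; exists (s + e) => //=.
apply: (summable_powR_counting (s := s) (x0 := x0) dM).
- by rewrite addr_ge0// ltW.
- by rewrite ltrDl.
- exact: lt_trans x01.
- move=> x x0x; rewrite -growth_leP; last exact: lt_le_trans x0x.
  by apply: growthV; exact: lt_le_trans x0x.
Qed.

End CountingAndSeries.

(** * Positivity and uniform boundedness of diameters *)

Section Diameter.
Set Implicit Arguments.
Unset Strict Implicit.
Unset Printing Implicit Defensive.
Variable R : realType.
Implicit Types (p q : R * R) (A C : set (R * R)) (M : R).

(** In the max norm each coordinate differs by at most [2 * M], so the squared distance is at most
    [8 * M ^+ 2]; 4 is a convenient, non-optimal constant. *)
Lemma edist_le p q M : `|p| <= M -> `|q| <= M -> edist p q <= 4 * M.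
Proof.
rewrite /Num.norm/= !ge_max => /andP[p1 p2] /andP[q1 q2].
have M0 : 0 <= M by apply: le_trans p1.
rewrite -[leRHS]ger0_norm ?mulr_ge0// -sqrtr_sqr ler_wsqrtr//.
move: p1 p2 q1 q2; rewrite !ler_norml.
move=> /andP[? ?] /andP[? ?] /andP[? ?] /andP[? ?].
nra.
Qed.

Lemma edist_gt0 p q : p <> q -> 0 < edist p q.
Proof.
move=> pq; rewrite /edist sqrtr_gt0 lt_neqAle addr_ge0 ?sqr_ge0// andbT eq_sym.
rewrite paddr_eq0 ?sqr_ge0// !sqrf_eq0 !subr_eq0.
apply/negP => /andP[/eqP e1 /eqP e2].
by apply: pq; rewrite (surjective_pairing p) e1 e2 -surjective_pairing.
Qed.

Lemma diam_bounds A M : (exists p q, [/\ A p, A q & p <> q]) ->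
  (forall p, A p -> `|p| <= M) -> 0 < diam A <= 4 * M.
Proof.
move=> [p [q [Ap Aq pq]]] AM.
(* Positivity relies on this bound too: the real [sup] dominates the elements of a set only when the
   set is bounded above. *)
have ub : ubound [set edist pq.1 pq.2 | pq in A `*` A] (4 * M).
  by move=> _ [[x y] [/= Ax Ay] <-]; apply: edist_le; exact: AM.
have Apq : [set edist pq.1 pq.2 | pq in A `*` A] (edist p q) by exists (p, q).
apply/andP; split; last by apply: ge_sup => //; exists (edist p q).
apply: (lt_le_trans (edist_gt0 pq)).
by apply: ub_le_sup => //; exists (4 * M).
Qed.

Lemma simple_closed_curve_neq C : simple_closed_curve C ->
  exists p q, [/\ C p, C q & p <> q].
Proof.
move=> [f [_ finj ->]].
have u1 : @unit_circle R (1, 0) by rewrite /unit_circle /=; ring.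
have u2 : @unit_circle R (0, 1) by rewrite /unit_circle /=; ring.
exists (f (1, 0)), (f (0, 1)); split; [by exists (1, 0)|by exists (0, 1)|].
move=> /finj; rewrite !inE => /(_ u1 u2) [] /eqP.
by rewrite oner_eq0.
Qed.

Lemma unit_circle_compact : compact (@unit_circle R).
Proof.
have I11 := @segment_compact R (-1) 1.
(* The circle is a closed subset of the compact square with side [[-1, 1]]. *)
apply: (subclosed_compact _ (compact_setX I11 I11)).
- apply: (@closed_comp _ _ (fun p : R * R => p.1 ^+ 2 + p.2 ^+ 2)
    [set x | x = 1]); last exact: closed_eq.
  by move=> p _; apply: cvgD; apply: cvgM; (exact: cvg_fst || exact: cvg_snd).
- move=> [x y]; rewrite /unit_circle /= !in_itv/= => xy.
  by split; apply/andP; split; nra.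
Qed.

Lemma bounded_setP A : bounded_set A -> exists M, forall p, A p -> `|p| <= M.
Proof.
move=> bA.
have [M _ AM] := @pinfty_ex_gt R 0 _ (real0 _) bA.
by exists M => p; exact: AM.
Qed.

Lemma simple_closed_curve_bounded C : simple_closed_curve C -> bounded_set C.
Proof.
move=> [f [fc _ ->]]; apply: compact_bounded.
by apply: continuous_compact => //; exact: unit_circle_compact.
Qed.

(** Closed balls are closed; this carries a bound on [D 0] over to the curves in its closure. *)
Lemma closure_norm_le A M : (forall p, A p -> `|p| <= M) ->
  forall p, closure A p -> `|p| <= M.
Proof.
move=> AM p /(@closureS _ A [set p | `|p| <= M] AM).
rewrite -(proj1 (closure_id _))//.
apply: (@closed_comp _ _ (fun p : R * R => `|p|) [set x | x <= M]) => [x _|].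
  exact: norm_continuous.
exact: closed_le.
Qed.

End Diameter.

Theorem theorem4 (R : realType) (C D : nat -> set (R * R)) (alpha : R)
    (hpack : packing C D) (halpha : 1 <= alpha)
    (hfat : forall k, exists (p : R * R) (rk Rk : R),
      concentric_circles (D k) p rk Rk /\ Rk / rk <= alpha) :
  limf_esup (fun x : R => (lne (curvature_distribution C x) / (ln x)%:E)%E) +oo
  = packing_exponent C.
Proof.
have [curveC boundedD subC _] := hpack.
have [M0 D0M0] := bounded_setP (proj1 (boundedD 0%N)).
have [M1 C0M1] := bounded_setP (simple_closed_curve_bounded (curveC 0%N)).
(* [M0] serves the curves of positive index, which lie in the closure of [D 0]; [M1] serves [C 0],
   bounded as a compact set. *)
apply: (@limf_esup_growth R (fun k => diam (C k)) (4 * Num.max M0 M1)) => k.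
apply: diam_bounds; first exact: simple_closed_curve_neq.
move=> p Cp; rewrite le_max; case: k Cp => [|k] Cp.
  by rewrite (C0M1 _ Cp) orbT.
by rewrite (closure_norm_le D0M0 (subC _ (ltn0Sn k) _ Cp)).
Qed.
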